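(* Let $N\ge2$ and consider $N\times N$ permutation matrices $\mathbf C=\sum_{j,k=0}^{N-1}c_{jk}|j\rangle\langle k|$. Consider the decision problem of determining whether $\langle0|\mathbf C|0\rangle=1$ or $\langle0|\mathbf C|0\rangle=0$. (i) Given oracle access to a block-encoding of $\mathbf C$, there is a quantum algorithm that solves this problem with probability $1$ using one query. (ii) Given instead oracle access to an (arbitrary, adversarially chosen) unitary $U_{\mathbf C}$ satisfying $U_{\mathbf C}|0\rangle=|C\rangle\rangle/\||C\rangle\rangle\|=\frac1{\sqrt N}\sum_{j,k}c_{jk}|j,k\rangle$, together with its inverse and controlled versions, any quantum algorithm that solves the problem with probability at least $2/3$ on every instance requires $\Omega(\sqrt N)$ queries.
   Context: Vectorization: for ${\bf F}=\sum_{j,k}f_{jk}|j\rangle\langle k|$, $|F\rangle\rangle:=\sum_{j,k}f_{jk}|j,k\rangle$. A block-encoding of a matrix ${\bf M}\in\mathbb C^{N\times N}$ with $\|{\bf M}\|\le\alpha$ is a unitary $U$ acting on $\mathbb C^N\otimes\mathbb C^{d}$ (ancilla dimension $d\ge1$) with $(\mathbb 1_N\otimes\langle0|)U(\mathbb 1_N\otimes|0\rangle)={\bf M}/\alpha$; here $\alpha=1$. Query counts include queries to inverses and controlled versions of the oracle. *)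

(* Defs.v *)
From HB Require Import structures.
From mathcomp Require Import all_boot all_order all_algebra all_fingroup.
From mathcomp Require Import complex mxtens.
From mathcomp Require Import reals.
Set Implicit Arguments. Unset Strict Implicit. Unset Printing Implicit Defensive.
Import Order.TTheory GRing.Theory Num.Theory.
Local Open Scope ring_scope.

Section QDefs.
Variable R : realType.
Local Notation C := (R[i]).

Definition adjmx m n (A : 'M[C]_(m, n)) : 'M[C]_(n, m) := (map_mx Num.conj A)^T.

Definition qunitary n (U : 'M[C]_n) : Prop :=
  U *m adjmx U = 1%:M /\ adjmx U *m U = 1%:M.

Definition ket n (j : 'I_n) : 'cV[C]_n := delta_mx j 0.

(* |0> in C^n (the zero vector if n = 0; only used with n > 0) *)
Definition ket0 n : 'cV[C]_n := \col_(p < n) ((nat_of_ord p == 0%N)%:R).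

Definition is_perm_matrix N (M : 'M[C]_N) : Prop := exists s : 'S_N, M = perm_mx s.

Definition vecmx N (F : 'M[C]_N) : 'cV[C]_(N * N) :=
  \sum_(j < N) \sum_(k < N) F j k *: (ket j *t ket k).

Definition id_ket0 N d : 'M[C]_(N * d.+1, N) :=
  castmx (erefl, muln1 N) ((1%:M : 'M[C]_N) *t ket (ord0 : 'I_d.+1)).

Definition block_encoding N d (M : 'M[C]_N) (U : 'M[C]_(N * d.+1)) : Prop :=
  qunitary U /\ adjmx (id_ket0 N d) *m U *m id_ket0 N d = M.

(* ---------------- quantum query algorithms ----------------
   The oracle O acts on C^m; the workspace is C^m (x) C^2 (x) C^w, where the
   C^2 factor is a control qubit.  Each query applies one of
   O, O^dagger, controlled-O, controlled-O^dagger (control = the qubit). *)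
Inductive qkind := QPlain | QInv | QCtrl | QCtrlInv.

Definition ctrlmx m w (A : 'M[C]_m) : 'M[C]_(m * (2 * w)) :=
  A *t ((ket (1 : 'I_2) *m (ket (1 : 'I_2))^T) *t (1%:M : 'M[C]_w))
  + (1%:M : 'M[C]_m) *t ((ket (0 : 'I_2) *m (ket (0 : 'I_2))^T) *t (1%:M : 'M[C]_w)).

Definition qgate m w (O : 'M[C]_m) (k : qkind) : 'M[C]_(m * (2 * w)) :=
  match k with
  | QPlain => O *t (1%:M : 'M[C]_(2 * w))
  | QInv => adjmx O *t (1%:M : 'M[C]_(2 * w))
  | QCtrl => ctrlmx w O
  | QCtrlInv => ctrlmx w (adjmx O)
  end.

(* An algorithm with T queries: unitaries V_0..V_T interleaved with queries
   kind_0..kind_{T-1}, starting from |0>, followed by a computational basis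
   measurement whose outcome p is mapped to the answer out p. *)
Record qalg (m w : nat) (T : nat) := QAlg {
  qa_V : nat -> 'M[C]_(m * (2 * w));
  qa_kind : nat -> qkind;
  qa_out : 'I_(m * (2 * w)) -> bool }.

Definition qalg_valid m w T (A : qalg m w T) : Prop :=
  forall t, (t <= T)%N -> qunitary (qa_V A t).

Fixpoint qstate m w T (A : qalg m w T) (O : 'M[C]_m) (t : nat) : 'cV[C]_(m * (2 * w)) :=
  match t with
  | 0 => qa_V A 0 *m ket0 _
  | t'.+1 => qa_V A t'.+1 *m (qgate w O (qa_kind A t') *m qstate A O t')
  end.

Definition prob_out m w T (A : qalg m w T) (O : 'M[C]_m) (b : bool) : C :=
  \sum_(p < m * (2 * w) | qa_out A p == b) `|qstate A O T p 0| ^+ 2.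

End QDefs.

(* Main.v *)
(* (i) The corner entry <0,0|U|0,0> of the block-encoding is C_00, so after one
   query on |0> the outcome 0 has probability |C_00|^2, which is 0 or 1.

   (ii) Compare C = 1 with the transposition C' = (0 1).  Their normalised
   vectorizations c, c' are at distance 2 / sqrt N, and the reflections
   exchanging |0> with c, resp. c', are valid oracles O, O' with
   |O - O'|_F^2 <= 64 / N.  By the hybrid argument T queries separate the two
   runs by at most T |O - O'|_F, while telling them apart with probability 2/3
   requires a constant separation.

   Square roots are avoided by replacing the triangle inequality by
   t |x + y|^2 <= (t + 1) |x|^2 + t (t + 1) |y|^2, under which a squared
   distance that starts at 0 and gains y at each step is at most t^2 |y|^2. *)
Require Import Defs.
From HB Require Import structures.
From mathcomp Require Import all_boot all_order all_algebra all_fingroup.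
From mathcomp Require Import complex mxtens reals ring lra.
Import Order.TTheory GRing.Theory Num.Theory.
Local Open Scope ring_scope.

(** * Adjoints and the squared Frobenius norm *)

Definition frob2 {R : realType} {m n} (A : 'M[R[i]]_(m, n)) : R[i] :=
  \tr (adjmx A *m A).

Lemma adjmxE {R : realType} {m n} (A : 'M[R[i]]_(m, n)) i j :
  adjmx A i j = (A j i)^*.
Proof. by rewrite !mxE. Qed.

Lemma adjmxK {R : realType} {m n} (A : 'M[R[i]]_(m, n)) : adjmx (adjmx A) = A.
Proof. by apply/matrixP => i j; rewrite !adjmxE conjCK. Qed.

Lemma adjmxM {R : realType} {m n p} (A : 'M[R[i]]_(m, n)) (B : 'M_(n, p)) :
  adjmx (A *m B) = adjmx B *m adjmx A.
Proof. by rewrite /adjmx map_mxM trmx_mul. Qed.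

Lemma adjmxD {R : realType} {m n} (A B : 'M[R[i]]_(m, n)) :
  adjmx (A + B) = adjmx A + adjmx B.
Proof. by rewrite /adjmx map_mxD linearD. Qed.

Lemma adjmxB {R : realType} {m n} (A B : 'M[R[i]]_(m, n)) :
  adjmx (A - B) = adjmx A - adjmx B.
Proof. by rewrite /adjmx map_mxB linearB. Qed.

Lemma adjmxZ {R : realType} {m n} a (A : 'M[R[i]]_(m, n)) :
  adjmx (a *: A) = a^* *: adjmx A.
Proof. by rewrite /adjmx map_mxZ linearZ. Qed.

Lemma adjmx1 {R : realType} n : adjmx (1%:M : 'M[R[i]]_n) = 1%:M.
Proof. by rewrite /adjmx map_mx1 trmx1. Qed.

Lemma adjmx_tens {R : realType} {m n p q} (A : 'M[R[i]]_(m, n))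
    (B : 'M[R[i]]_(p, q)) : adjmx (A *t B) = adjmx A *t adjmx B.
Proof. by rewrite /adjmx map_mxT trmx_tens. Qed.

Lemma frob2E {R : realType} {m n} (A : 'M[R[i]]_(m, n)) :
  frob2 A = \sum_j \sum_i `|A i j| ^+ 2.
Proof.
apply: eq_bigr => j _; rewrite !mxE; apply: eq_bigr => i _.
by rewrite !mxE normCK mulrC.
Qed.

Lemma frob2_cV {R : realType} {m} (x : 'cV[R[i]]_m) :
  frob2 x = \sum_i `|x i 0| ^+ 2.
Proof. by rewrite frob2E big_ord1. Qed.

Lemma frob2_ge0 {R : realType} {m n} (A : 'M[R[i]]_(m, n)) : 0 <= frob2 A.
Proof. by rewrite frob2E; do 2!apply: sumr_ge0 => ? _; rewrite exprn_ge0. Qed.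

Lemma frob2_unitary {R : realType} {m n} (U : 'M[R[i]]_m) (A : 'M_(m, n)) :
  qunitary U -> frob2 (U *m A) = frob2 A.
Proof.
by case=> _ UU; rewrite /frob2 adjmxM -mulmxA (mulmxA _ U) UU mul1mx.
Qed.

(** Pythagoras for an orthogonal projection: the deficit is exactly [frob2 ((1%:M - Q) *m A)]. *)
Lemma frob2_proj {R : realType} {m n} (Q : 'M[R[i]]_m) (A : 'M_(m, n)) :
  adjmx Q = Q -> Q *m Q = Q -> frob2 (Q *m A) <= frob2 A.
Proof.
move=> hQ QQ; rewrite -subr_ge0.
suff -> : frob2 A - frob2 (Q *m A) = frob2 ((1%:M - Q) *m A) by apply: frob2_ge0.
rewrite /frob2 !adjmxM adjmxB adjmx1 hQ -!mulmxA (mulmxA Q Q) QQ.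
rewrite -linearB -mulmxBr; congr (\tr (_ *m _)).
by rewrite mulmxBl mul1mx !mulmxBl !mul1mx !mulmxBr mulmxA QQ subrr subr0.
Qed.

(** * Cauchy-Schwarz and square-root-free triangle inequalities *)

(** By Lagrange's identity, twice the gap between the two sides is the double sum of the squares
    [|a_i b_j^* - a_j b_i^*|^2]. *)
Lemma cauchy_schwarz_sum {R : realType} {n} (a b : 'I_n -> R[i]) :
  `|\sum_i a i * b i| ^+ 2 <= (\sum_i `|a i| ^+ 2) * \sum_i `|b i| ^+ 2.
Proof.
rewrite -subr_ge0 -(@pmulr_rge0 _ 2) ?ltr0n //.
set S := 2 * _.
suff -> : S = \sum_i \sum_j `|a i * (b j)^* - a j * (b i)^*| ^+ 2.
  by do 2!apply: sumr_ge0 => ? _; rewrite exprn_ge0.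
pose X := \sum_i \sum_j `|a i| ^+ 2 * `|b j| ^+ 2.
pose Y := \sum_i \sum_j (a i * b i) * (a j * b j)^*.
have XE : (\sum_i `|a i| ^+ 2) * (\sum_i `|b i| ^+ 2) = X.
  by rewrite mulr_suml; apply: eq_bigr => i _; rewrite mulr_sumr.
have YE : `|\sum_i a i * b i| ^+ 2 = Y.
  rewrite normCK rmorph_sum mulr_suml; apply: eq_bigr => i _.
  by rewrite mulr_sumr.
(* Each double sum is used once as it stands and once with [i] and [j] exchanged; this
   symmetrization turns [2 * (X - Y)] termwise into squares. *)
have XE' : X = \sum_i \sum_j `|a j| ^+ 2 * `|b i| ^+ 2 by rewrite exchange_big.
have YE' : Y = \sum_i \sum_j (a j * b j) * (a i * b i)^* by rewrite exchange_big.
rewrite /S XE YE mulr2n mulrDl mul1r {1}XE' {1}YE' /X /Y.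
rewrite -!sumrB -big_split; apply: eq_bigr => i _.
rewrite -!sumrB -big_split; apply: eq_bigr => j _ /=.
by rewrite !normCK !(rmorphB, rmorphM) /= !conjCK; ring.
Qed.

(** The difference of the two sides is the perfect square [|x - t y|^2]. *)
Lemma normD_young {R : realType} (t : nat) (x y : R[i]) :
  t%:R * `|x + y| ^+ 2 <= t.+1%:R * `|x| ^+ 2 + (t * t.+1)%N%:R * `|y| ^+ 2.
Proof.
rewrite -subr_ge0.
suff -> : t.+1%:R * `|x| ^+ 2 + (t * t.+1)%N%:R * `|y| ^+ 2 - t%:R * `|x + y| ^+ 2
          = `|x - t%:R * y| ^+ 2 by rewrite exprn_ge0.
rewrite !normCK !(rmorphB, rmorphD, rmorphM) /= -natr1 conjC_nat; ring.
Qed.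

Lemma frob2D_young {R : realType} (t : nat) {m} (x y : 'cV[R[i]]_m) :
  t%:R * frob2 (x + y) <= t.+1%:R * frob2 x + (t * t.+1)%N%:R * frob2 y.
Proof.
rewrite !frob2_cV !mulr_sumr -big_split; apply: ler_sum => i _.
by rewrite mxE normD_young.
Qed.

(** * Tensor products and controlled gates *)

Lemma sum_mxtens {V : nmodType} {m n} (F : 'I_(m * n) -> V) :
  \sum_p F p = \sum_i \sum_j F (mxtens_index (i, j)).
Proof.
rewrite pair_big /= (reindex (@mxtens_index m n)) /=.
  by apply: eq_bigr => -[].
exists (@mxtens_unindex m n) => ? _; first exact: mxtens_indexK.
exact: mxtens_unindexK.
Qed.

Lemma frob2_tens1 {R : realType} {m w} (D : 'M[R[i]]_m) (x : 'cV[R[i]]_(m * w)) :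
  frob2 ((D *t (1%:M : 'M_w)) *m x) <= frob2 D * frob2 x.
Proof.
have entry i a : ((D *t (1%:M : 'M_w)) *m x) (mxtens_index (i, a)) 0 =
    \sum_j D i j * x (mxtens_index (j, a)) 0.
  rewrite mxE sum_mxtens; apply: eq_bigr => j _.
  rewrite (bigD1 a) //= big1 ?addr0; first by rewrite tensmxE mxE eqxx mulr1.
  by move=> b /negPf nb; rewrite tensmxE mxE eq_sym nb mulr0 mul0r.
rewrite (frob2E D) exchange_big /= !frob2_cV !sum_mxtens mulr_suml.
apply: ler_sum => i _.
apply: le_trans (_ : \sum_a (\sum_j `|D i j| ^+ 2) *
   \sum_j `|x (mxtens_index (j, a)) 0| ^+ 2 <= _); last first.
  by rewrite -mulr_sumr exchange_big.
by apply: ler_sum => a _; rewrite entry cauchy_schwarz_sum.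
Qed.

Lemma tensmxDr {R : pzRingType} {m n p q} (A : 'M[R]_(m, n)) (B B' : 'M[R]_(p, q)) :
  A *t (B + B') = A *t B + A *t B'.
Proof. by apply/matrixP => i j; rewrite !mxE mulrDr. Qed.

Lemma tensmxBl {R : pzRingType} {m n p q} (A A' : 'M[R]_(m, n)) (B : 'M[R]_(p, q)) :
  (A - A') *t B = A *t B - A' *t B.
Proof. by apply/matrixP => i j; rewrite !mxE mulrBl. Qed.

Lemma tensmx11 {R : pzRingType} m n : (1%:M : 'M[R]_m) *t (1%:M : 'M_n) = 1%:M.
Proof.
apply/matrixP => i j; case: (mxtens_indexP i) => i1 i2.
case: (mxtens_indexP j) => j1 j2; rewrite tensmxE !mxE -natrM mulnb.
by rewrite (can_eq (@mxtens_indexK m n)) xpair_eqE.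
Qed.

Lemma ketK {R : realType} {n} (j k : 'I_n) :
  (ket R j)^T *m ket R k = (j == k)%:R%:M.
Proof.
rewrite /ket trmx_delta; have [->|njk] := eqVneq j k.
  by rewrite mul_delta_mx; apply/matrixP => a b; rewrite !ord1 !mxE.
by rewrite mul_delta_mx_0 // raddf0.
Qed.

(** The projector onto value [b] of the control qubit; in these terms a controlled gate is [A] on
    the branch 1 and the identity on the branch 0. *)
Definition qproj {R : realType} w (b : 'I_2) : 'M[R[i]]_(2 * w) :=
  (ket R b *m (ket R b)^T) *t (1%:M : 'M_w).

Lemma qprojM {R : realType} w b c :
  qproj w b *m qproj w c = if b == c then qproj w b else 0 :> 'M[R[i]]_(2 * w).
Proof.
rewrite tensmx_mul mul1mx mulmxA -(mulmxA (ket R b)) ketK mul_mx_scalar.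
by have [->|_] := eqVneq; rewrite ?scale1r // scale0r mul0mx tens0mx.
Qed.

Lemma adjmx_qproj {R : realType} w b : adjmx (qproj w b) = qproj w b :> 'M[R[i]]_(2 * w).
Proof.
rewrite adjmx_tens adjmx1 adjmxM; congr (_ *t _).
by rewrite /adjmx -!map_trmx trmxK map_delta_mx.
Qed.

Lemma qprojD {R : realType} w : qproj w 1 + qproj w 0 = 1%:M :> 'M[R[i]]_(2 * w).
Proof.
rewrite -tensmx11; apply/matrixP => i j; rewrite !mxE -mulrDl; congr (_ * _).
rewrite !big_ord1 !mxE !eqxx !andbT -!natrM -natrD.
by case: (mxtens_unindex i).1 => -[|[|//]] ?; case: (mxtens_unindex j).1 => -[|[|//]] ?.
Qed.

Lemma ctrlmxE {R : realType} {m} w (A : 'M[R[i]]_m) :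
  ctrlmx w A = A *t qproj w 1 + 1%:M *t qproj w 0.
Proof. by []. Qed.

Lemma adjmx_ctrl {R : realType} {m} w (O : 'M[R[i]]_m) :
  adjmx (ctrlmx w O) = ctrlmx w (adjmx O).
Proof.
by rewrite !ctrlmxE adjmxD !(adjmx_tens _ (qproj w _)) !adjmx_qproj adjmx1.
Qed.

Lemma ctrlmxM {R : realType} {m} w (A B : 'M[R[i]]_m) :
  ctrlmx w A *m ctrlmx w B = ctrlmx w (A *m B).
Proof.
rewrite !ctrlmxE mulmxDl !mulmxDr !(tensmx_mul _ (qproj w _)) !qprojM /=.
by rewrite !tensmx0 addr0 add0r !mul1mx.
Qed.

Lemma ctrlmx1 {R : realType} m w : ctrlmx w (1%:M : 'M[R[i]]_m) = 1%:M.
Proof. by rewrite !ctrlmxE -tensmxDr qprojD tensmx11. Qed.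

Lemma qunitary_adj {R : realType} {m} (U : 'M[R[i]]_m) :
  qunitary U -> qunitary (adjmx U).
Proof. by case=> UU' U'U; split; rewrite adjmxK. Qed.

Lemma qgate_unitary {R : realType} {m} w (O : 'M[R[i]]_m) k :
  qunitary O -> qunitary (qgate w O k).
Proof.
have plain U : qunitary U -> qunitary (qgate w U QPlain).
  by move=> [UU' U'U]; split;
     rewrite /= adjmx_tens adjmx1 tensmx_mul mul1mx ?UU' ?U'U tensmx11.
have ctrl U : qunitary U -> qunitary (qgate w U QCtrl).
  by move=> [UU' U'U]; split;
     rewrite /= adjmx_ctrl ctrlmxM ?UU' ?U'U ctrlmx1.
by case: k => uO; [exact: plain | exact/plain/qunitary_adj
                  | exact: ctrl | exact/ctrl/qunitary_adj].
Qed.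

(** * The hybrid argument *)

Lemma frob2_adj {R : realType} {m n} (A : 'M[R[i]]_(m, n)) : frob2 (adjmx A) = frob2 A.
Proof. by rewrite /frob2 adjmxK mxtrace_mulC. Qed.

(** In the controlled cases the identity branches cancel. What is left is [(U - U') *t 1] after the
    projection onto control value 1, which cannot increase the norm. Inverse queries reduce to
    direct ones since taking adjoints preserves [frob2]. *)
Lemma frob2_qgateB {R : realType} {m} w (O O' : 'M[R[i]]_m) k
    (x : 'cV[R[i]]_(m * (2 * w))) :
  frob2 ((qgate w O k - qgate w O' k) *m x) <= frob2 (O - O') * frob2 x.
Proof.
have ctrl (U U' : 'M[R[i]]_m) :
    frob2 ((ctrlmx w U - ctrlmx w U') *m x) <= frob2 (U - U') * frob2 x.
  rewrite !ctrlmxE opprD addrACA subrr addr0 -tensmxBl tensmx_decr.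
  rewrite -mulmxA; apply: le_trans (frob2_tens1 _ _) _.
  apply: ler_wpM2l; first exact: frob2_ge0.
  by apply: frob2_proj;
     [rewrite adjmx_tens adjmx1 adjmx_qproj | rewrite tensmx_mul mul1mx qprojM].
case: k => /=; first by rewrite -tensmxBl frob2_tens1.
- by rewrite -tensmxBl -adjmxB -(frob2_adj (O - O')) frob2_tens1.
- exact: ctrl.
- by rewrite -(frob2_adj (O - O')) adjmxB ctrl.
Qed.

Lemma frob2_ket0 {R : realType} m : frob2 (ket0 R m) = (0 < m)%N%:R.
Proof.
rewrite frob2_cV; case: m => [|m]; first by rewrite big_ord0.
rewrite big_ord_recl big1 => [|i _]; rewrite !mxE /= ?normr0 ?expr0n //.
by rewrite normr1 expr1n addr0.
Qed.

Lemma frob2_qstate {R : realType} {m w T} (A : qalg R m w T) O t :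
  qalg_valid A -> qunitary O -> (t <= T)%N -> frob2 (qstate A O t) <= 1.
Proof.
move=> vA uO; elim: t => [|t IH] le_tT /=.
  by rewrite frob2_unitary ?frob2_ket0 ?lern1 ?leq_b1 //; apply: vA.
rewrite frob2_unitary; last exact: vA.
by rewrite frob2_unitary ?IH 1?ltnW //; apply: qgate_unitary.
Qed.

Lemma frob2_qstateB {R : realType} {m w T} (A : qalg R m w T) O O' t :
  qalg_valid A -> qunitary O -> qunitary O' -> (t <= T)%N ->
  frob2 (qstate A O t - qstate A O' t) <= (t ^ 2)%N%:R * frob2 (O - O').
Proof.
move=> vA uO uO'; elim: t => [|t IH] le_tT /=.
  by rewrite subrr mul0r /frob2 mulmx0 linear0.
rewrite -mulmxBr frob2_unitary; last exact: vA.
set G := qgate w O _; set G' := qgate w O' _.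
set x := qstate A O t; set x' := qstate A O' t.
(* The old error is carried along by the unitary [G']; the new error is [G - G'] applied to a state
   of norm at most 1. *)
have -> : G *m x - G' *m x' = G' *m (x - x') + (G - G') *m x.
  by rewrite mulmxBr mulmxBl [RHS]addrC subrKA.
have uG' : qunitary G' by apply: qgate_unitary.
have step : frob2 ((G - G') *m x) <= frob2 (O - O').
  apply: le_trans (frob2_qgateB _ _ _ _ _) _.
  by rewrite ler_piMr ?frob2_ge0 // frob2_qstate // ltnW.
(* The first query is treated apart: Young's inequality with weight 0 on the left would say nothing.
   Afterwards the number of earlier queries is [t.+1], which serves as the weight, and the bounds
   add up by [(t+2)(t+1)^2 + (t+1)(t+2) = (t+1)(t+2)^2]. *)
case: t => [|t] in le_tT IH G G' x x' uG' step *.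
  by rewrite {1}/x /x' /= subrr mulmx0 add0r mul1r.
rewrite -(ler_pM2l (ltr0Sn _ t)); apply: le_trans (frob2D_young _ _ _) _.
rewrite frob2_unitary //; have {IH} := IH (ltnW le_tT).
move=> /(ler_wpM2l (ler0n R[i] t.+2)) IH.
move: step => /(ler_wpM2l (ler0n R[i] (t.+1 * t.+2))) /(lerD IH) le_sum.
apply: le_trans le_sum _.
rewrite !mulrA -mulrDl ler_wpM2r ?frob2_ge0 //.
by rewrite -!natrM -natrD ler_nat; apply: eq_leq; rewrite !expnS !expn0; ring.
Qed.

Lemma prob_outD {R : realType} {m w T} (A : qalg R m w T) O :
  prob_out A O true + prob_out A O false = frob2 (qstate A O T).
Proof.
rewrite frob2_cV (bigID (qa_out A)) /prob_out; congr (_ + _).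
  by apply: eq_bigl => p; rewrite eqb_id.
by apply: eq_bigl => p; rewrite eqbF_neg.
Qed.

(** Young's inequality with weight 2 at each outcome, then the error is summed over all outcomes.
    Weight 1 would be too weak: probabilities 2/3 and 1/3 would give only [2/3 <= 2/3] plus the
    error. *)
Lemma prob_out_young {R : realType} {m w T} (A : qalg R m w T) O O' b :
  2 * prob_out A O b <=
  3 * prob_out A O' b + 6 * frob2 (qstate A O T - qstate A O' T).
Proof.
set x := qstate A O T; set x' := qstate A O' T.
apply: le_trans (_ : 3 * prob_out A O' b +
  6 * \sum_(p | qa_out A p == b) `|(x - x') p 0| ^+ 2 <= _).
  rewrite !mulr_sumr -big_split; apply: ler_sum => p _ /=.
  have -> : qstate A O T p 0 = x' p 0 + (x - x') p 0 by rewrite !mxE [RHS]addrC subrK.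
  exact: (normD_young 2).
rewrite lerD2l ler_wpM2l ?ler0n // frob2_cV.
rewrite [leRHS](bigID (fun p => qa_out A p == b)) /= lerDl.
by apply: sumr_ge0 => p _; rewrite exprn_ge0.
Qed.

(** Answering false on [O'] with probability 2/3 leaves at most 1/3 for true, so
    [4/3 <= 1 + 6 T^2 |O - O'|^2]; multiplying by 3 gives the constant 18. *)
Lemma query_bound {R : realType} {m w T} (A : qalg R m w T) O O' :
  qalg_valid A -> qunitary O -> qunitary O' ->
  2 / 3 <= prob_out A O true -> 2 / 3 <= prob_out A O' false ->
  1 <= 18 * (T ^ 2)%N%:R * frob2 (O - O').
Proof.
move=> vA uO uO' pt pf.
have := frob2_qstate A O' T vA uO' (leqnn T); rewrite -prob_outD => tot.
have := frob2_qstateB A O O' T vA uO uO' (leqnn T) => dist.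
have := prob_out_young A O O' true => young.
have pt' : prob_out A O' true <= 3^-1.
  have := le_trans (lerD (lexx _) pf) tot.
  rewrite -lerBrDr; suff -> : 1 - 2 / 3 = 3^-1 :> R[i] by [].
  by field.
have : 2 * (2 / 3) <= 3 * 3^-1 + 6 * ((T ^ 2)%N%:R * frob2 (O - O')).
  apply: le_trans (ler_wpM2l (ler0n _ 2) pt) _; apply: le_trans young _.
  by rewrite lerD // ler_wpM2l ?ler0n.
rewrite -subr_ge0 => /(mulr_ge0 (ler0n _ 3)) h; rewrite -subr_ge0.
by move: h; congr (0 <= _); field.
Qed.

(** * Inner products and Householder reflections *)

Definition dotmx {R : realType} {m} (u v : 'cV[R[i]]_m) : R[i] := (adjmx u *m v) 0 0.

Lemma dotmxE {R : realType} {m} (u v : 'cV[R[i]]_m) :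
  dotmx u v = \sum_p (u p 0)^* * v p 0.
Proof. by rewrite /dotmx mxE; apply: eq_bigr => p _; rewrite adjmxE. Qed.

Lemma dotmxC {R : realType} {m} (u v : 'cV[R[i]]_m) : (dotmx u v)^* = dotmx v u.
Proof. by rewrite /dotmx -adjmxE adjmxM adjmxK. Qed.

Lemma dotmxBl {R : realType} {m} (u u' v : 'cV[R[i]]_m) :
  dotmx (u - u') v = dotmx u v - dotmx u' v.
Proof. by rewrite /dotmx adjmxB mulmxBl !mxE. Qed.

Lemma dotmxBr {R : realType} {m} (u v v' : 'cV[R[i]]_m) :
  dotmx u (v - v') = dotmx u v - dotmx u v'.
Proof. by rewrite /dotmx mulmxBr !mxE. Qed.

Lemma dotmxZZ {R : realType} {m} a b (u v : 'cV[R[i]]_m) :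
  dotmx (a *: u) (b *: v) = a^* * b * dotmx u v.
Proof. by rewrite /dotmx adjmxZ -scalemxAl -scalemxAr scalerA mxE. Qed.

Lemma rank1_mulmx {R : realType} {m n} (u : 'cV[R[i]]_n) (v w : 'cV[R[i]]_m) :
  u *m adjmx v *m w = dotmx v w *: u.
Proof. by rewrite -mulmxA [adjmx v *m w]mx11_scalar mul_mx_scalar. Qed.

Lemma trace_rank1 {R : realType} {m} (u v : 'cV[R[i]]_m) :
  \tr (u *m adjmx v) = dotmx v u.
Proof. by rewrite mxtrace_mulC /mxtrace big_ord1. Qed.

Definition line_proj {R : realType} {m} (v : 'cV[R[i]]_m) : 'M[R[i]]_m :=
  (dotmx v v)^-1 *: (v *m adjmx v).

Lemma adjmx_line_proj {R : realType} {m} (v : 'cV[R[i]]_m) :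
  adjmx (line_proj v) = line_proj v.
Proof. by rewrite adjmxZ adjmxM adjmxK fmorphV /= dotmxC. Qed.

Lemma line_projM {R : realType} {m} (v w : 'cV[R[i]]_m) :
  line_proj v *m line_proj w =
  ((dotmx v v)^-1 * (dotmx w w)^-1 * dotmx v w) *: (v *m adjmx w).
Proof.
by rewrite /line_proj -scalemxAl -scalemxAr mulmxA rank1_mulmx -scalemxAl !scalerA mulrA.
Qed.

Lemma line_proj_idem {R : realType} {m} (v : 'cV[R[i]]_m) :
  dotmx v v != 0 -> line_proj v *m line_proj v = line_proj v.
Proof. by move=> nz; rewrite line_projM -mulrA mulVf // mulr1. Qed.

Definition householder {R : realType} {m} (v : 'cV[R[i]]_m) : 'M[R[i]]_m :=
  1%:M - 2 *: line_proj v.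

Lemma householder_unitary {R : realType} {m} (v : 'cV[R[i]]_m) :
  dotmx v v != 0 -> qunitary (householder v).
Proof.
move=> nz; have hH : adjmx (householder v) = householder v.
  by rewrite adjmxB adjmx1 adjmxZ adjmx_line_proj conjC_nat.
rewrite /qunitary hH; suff : householder v *m householder v = 1%:M by [].
rewrite mulmxBl !mulmxBr mul1mx !mulmx1 mul1mx -scalemxAl -scalemxAr.
by rewrite line_proj_idem // [2 *: (2 *: _)]scaler_nat mulr2n opprB addrK subrK.
Qed.

(** Equal norms and a real inner product give [2 <e-c, e> = <e-c, e-c>], so the reflection subtracts
    exactly [e - c] from [e]. *)
Lemma householder_swap {R : realType} {m} (e c : 'cV[R[i]]_m) :
  dotmx e e = 1 -> dotmx c c = 1 -> dotmx c e = dotmx e c ->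
  dotmx (e - c) (e - c) != 0 -> householder (e - c) *m e = c.
Proof.
move=> ee cc ce nz; rewrite mulmxBl mul1mx -!scalemxAl rank1_mulmx !scalerA.
suff -> : 2 / dotmx (e - c) (e - c) * dotmx (e - c) e = 1.
  by rewrite scale1r opprB addrC subrK.
apply: (mulIf nz); rewrite mul1r mulrAC divfK // .
by rewrite !(dotmxBl, dotmxBr) ee cc ce; ring.
Qed.

(** The left side is four times the trace of the square of a difference of two rank-one projections.
    Each projection has trace 1, and the cross terms give the squared overlap of the two lines. *)
Lemma frob2_householderB {R : realType} {m} (v w : 'cV[R[i]]_m) :
  dotmx v v != 0 -> dotmx w w != 0 ->
  frob2 (householder v - householder w) =
  8 - 8 * (dotmx v w * dotmx w v / (dotmx v v * dotmx w w)).
Proof.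
move=> nv nw.
have -> : householder v - householder w = 2 *: (line_proj w - line_proj v).
  by rewrite /householder opprB addrACA addrC addrA subrK scalerBr addrC.
rewrite /frob2 adjmxZ adjmxB !adjmx_line_proj conjC_nat -scalemxAl -scalemxAr.
rewrite mulmxBl !mulmxBr !line_proj_idem // !line_projM.
have trB (A B : 'M[R[i]]_m) : \tr (A - B) = \tr A - \tr B by exact: raddfB.
rewrite !mxtraceZ !trB !mxtraceZ !trace_rank1.
by field; rewrite nv nw.
Qed.

(** * Vectorized permutations and the two hard oracles *)

Lemma vecmxE {R : realType} {N} (F : 'M[R[i]]_N) j k :
  vecmx F (mxtens_index (j, k)) 0 = F j k.
Proof.
have entry j' k' : (F j' k' *: (ket R j' *t ket R k')) (mxtens_index (j, k)) 0 =
    if (j' == j) && (k' == k) then F j k else 0.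
  rewrite mxE (_ : 0 = mxtens_index (0 : 'I_1, 0 : 'I_1)); last exact: val_inj.
  rewrite tensmxE !mxE !eqxx !andbT -natrM mulnb !(eq_sym _ j') !(eq_sym _ k').
  by case: ifP => [/andP[/eqP-> /eqP->]|_]; rewrite ?mulr1 ?mulr0.
rewrite /vecmx summxE.
under eq_bigr => j' _.
  rewrite summxE; under eq_bigr => k' _ do rewrite entry.
  over.
by rewrite pair_big /= -big_mkcond (big_pred1 (j, k)).
Qed.

(** Row [j] of a permutation matrix has its single 1 in column [s j], so the inner product counts
    the points where the permutations agree. *)
Lemma dotmx_vec_perm {R : realType} {N} (s t : 'S_N) :
  dotmx (vecmx (perm_mx s)) (vecmx (perm_mx t)) = \sum_j (s j == t j)%:R :> R[i].
Proof.
rewrite dotmxE sum_mxtens; apply: eq_bigr => j _.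
rewrite (bigD1 (s j)) //= big1 ?addr0 => [|k /negPf nk].
  by rewrite !vecmxE !mxE eqxx conjC1 mul1r eq_sym.
by rewrite !vecmxE !mxE eq_sym nk conjC0 mul0r.
Qed.

Lemma dotmx_ket0 {R : realType} {N} (x : 'cV[R[i]]_(N.+1 * N.+1)) :
  dotmx (ket0 R _) x = x (mxtens_index (0, 0)) 0.
Proof.
rewrite dotmxE (bigD1 (mxtens_index (0, 0))) //= big1 ?addr0 => [|p np].
  by rewrite mxE conjC1 mul1r.
by rewrite mxE (_ : val p == 0%N = false) ?conjC0 ?mul0r //; apply/negbTE.
Qed.

Lemma real_conjC {R : realType} (x : R) : (x%:C%C)^* = x%:C%C.
Proof. exact: conjc_real. Qed.

Lemma close_oracles {R : realType} {m} (e c c' : 'cV[R[i]]_m) (r : R) :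
  0 < r -> r ^+ 2 <= 1 / 2 ->
  dotmx e e = 1 -> dotmx c c = 1 -> dotmx c' c' = 1 ->
  dotmx e c = r%:C%C -> dotmx e c' = 0 -> dotmx c c' = (1 - 2 * r ^+ 2)%:C%C ->
  exists O O' : 'M[R[i]]_m, [/\ qunitary O, qunitary O', O *m e = c, O' *m e = c' &
    frob2 (O - O') <= (64 * r ^+ 2)%:C%C].
Proof.
move=> r0 r12 ee cc cc' ec ec' cd.
have ce : dotmx c e = r%:C%C by rewrite -dotmxC ec real_conjC.
have ce' : dotmx c' e = 0 by rewrite -dotmxC ec' conjC0.
have dc : dotmx c' c = (1 - 2 * r ^+ 2)%:C%C by rewrite -dotmxC cd real_conjC.
(* This keeps [2 - 2r], the squared length of [e - c], away from 0. *)
have r34 : r <= 3 / 4 by nra.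
have dot_real := (@dotmxBl R m, @dotmxBr R m, ee, cc, cc', ec, ec', ce, ce', cd, dc).
have vv : dotmx (e - c) (e - c) = (2 - 2 * r)%:C%C.
  by rewrite !dot_real !(rmorphB, rmorphM, rmorph1, rmorph_nat) /=; ring.
have ww : dotmx (e - c') (e - c') = 2%:C%C.
  by rewrite !dot_real rmorph_nat; ring.
have vw : dotmx (e - c) (e - c') = (2 - r - 2 * r ^+ 2)%:C%C.
  by rewrite !dot_real !(rmorphB, rmorphM, rmorph1, rmorph_nat) /=; ring.
have wv : dotmx (e - c') (e - c) = (2 - r - 2 * r ^+ 2)%:C%C.
  by rewrite -dotmxC vw real_conjC.
have nv : dotmx (e - c) (e - c) != 0.
  by rewrite vv -[0]/(0%:C%C) (inj_eq (@complexI _)); apply/eqP; lra.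
have nw : dotmx (e - c') (e - c') != 0.
  by rewrite ww -[0]/(0%:C%C) (inj_eq (@complexI _)); apply/eqP; lra.
exists (householder (e - c)), (householder (e - c')); split.
- exact: householder_unitary.
- exact: householder_unitary.
- by apply: householder_swap; rewrite ?ec ?ce.
- by apply: householder_swap; rewrite ?ec' ?ce'.
rewrite frob2_householderB // vv ww vw wv.
rewrite -(rmorph_nat (real_complex R) 8) -!rmorphM -fmorphV -!rmorphM -rmorphB lecR.
have pos : 0 < (2 - 2 * r) * 2 by lra.
(* In [4(1 - r) - (2 - r - 2r^2)^2 = 7r^2 - 4r^3 - 4r^4] the terms linear in [r] cancel. Hence the
   distance is [2 r^2 (7 - 4r - 4r^2) / (1 - r)], at most [56 r^2] when [r <= 3/4]. *)
rewrite lerBlDr -lerBlDl mulrA ler_pdivlMr //; nra.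
Qed.

Lemma sum_tperm01 {R : realType} n :
  \sum_j ((1%g : 'S_n.+2) j == tperm 0 1 j)%:R = n%:R :> R[i].
Proof.
rewrite !big_ord_recl !perm1 tpermL.
rewrite (_ : lift ord0 ord0 = 1 :> 'I_n.+2) ?tpermR; last exact: val_inj.
rewrite !add0r (eq_bigr (fun=> 1)) ?sumr_const ?card_ord // => j _.
by rewrite perm1 tpermD ?eqxx.
Qed.

Lemma hard_oracles {R : realType} n :
  exists O O' : 'M[R[i]]_(n.+2 * n.+2),
    [/\ qunitary O, qunitary O',
      O *m ket0 R _ = (sqrtC (n.+2%:R : R[i]))^-1 *: vecmx (perm_mx 1),
      O' *m ket0 R _ = (sqrtC (n.+2%:R : R[i]))^-1 *: vecmx (perm_mx (tperm 0 1)) &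
      frob2 (O - O') <= (64 / n.+2%:R : R)%:C%C].
Proof.
pose r : R := (Num.sqrt n.+2%:R)^-1.
have r0 : 0 < r by rewrite invr_gt0 sqrtr_gt0 ltr0n.
have r2 : r ^+ 2 = n.+2%:R^-1 by rewrite exprVn sqr_sqrtr ?ler0n.
(* The complex and the real square root agree, being nonnegative with the same square. *)
have sE : (sqrtC (n.+2%:R : R[i]))^-1 = r%:C%C.
  rewrite /r fmorphV; congr _^-1; apply/eqP.
  rewrite -(@eqrXn2 _ 2) ?sqrtC_ge0 ?ler0n ?ler0c ?sqrtr_ge0 //.
  by rewrite sqrtCK -rmorphXn sqr_sqrtr ?ler0n // rmorph_nat.
have rr N : (r%:C%C)^* * r%:C%C * N = N / n.+2%:R :> R[i].
  by rewrite real_conjC -rmorphM -expr2 r2 fmorphV rmorph_nat mulrC.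
have n0 : (n.+2%:R : R[i]) != 0 by rewrite pnatr_eq0.
have ids (s : 'S_n.+2) : \sum_j (s j == s j)%:R = n.+2%:R :> R[i].
  by rewrite (eq_bigr (fun=> 1)) ?sumr_const ?card_ord // => j _; rewrite eqxx.
rewrite sE -r2; apply: close_oracles => //.
- by rewrite r2 div1r lef_pV2 ?posrE ?ltr0n // ler_nat.
- by rewrite dotmx_ket0 mxE.
- by rewrite dotmxZZ dotmx_vec_perm ids rr divff.
- by rewrite dotmxZZ dotmx_vec_perm ids rr divff.
- by rewrite dotmx_ket0 mxE vecmxE !mxE perm1 mulr1.
- by rewrite dotmx_ket0 mxE vecmxE !mxE tpermL mulr0.
(* The identity and the transposition agree at [n] of the [n+2] points, and
   [n/(n+2) = 1 - 2 r^2]. *)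
rewrite dotmxZZ dotmx_vec_perm sum_tperm01 rr r2.
rewrite rmorphB rmorphM fmorphV !rmorph_nat rmorph1.
apply: (mulIf n0); rewrite divfK // mulrBl mul1r divfK //.
by rewrite -[in n.+2]addn2 natrD addrK.
Qed.

(** * Block-encodings and the one-query algorithm *)

Lemma mulmx_ket0 {R : realType} {m} (M : 'M[R[i]]_m) p q :
  val q = 0%N -> (M *m ket0 R m) p 0 = M p q.
Proof.
move=> q0; rewrite mxE (bigD1 q) //= big1 ?addr0 => [|j nj].
  by rewrite mxE q0 mulr1.
by rewrite mxE -q0 (inj_eq val_inj) (negPf nj) mulr0.
Qed.

Lemma id_ket0E {R : realType} N d i a j :
  id_ket0 R N d (mxtens_index (i, a)) j = ((i == j) && (a == 0))%:R.
Proof.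
rewrite castmxE cast_ord_id.
rewrite (_ : cast_ord _ j = mxtens_index (j, 0 : 'I_1)); last first.
  by apply: val_inj; rewrite /= muln1 addn0.
by rewrite tensmxE !mxE andbT -natrM mulnb.
Qed.

(** Column [l] of [id_ket0] is the basis vector indexed by [(l, 0)], so the compression of [U] just
    selects entries. *)
Lemma block_encodingE {R : realType} {N d} (M : 'M[R[i]]_N) (U : 'M_(N * d.+1)) i j :
  block_encoding M U -> U (mxtens_index (i, 0)) (mxtens_index (j, 0)) = M i j.
Proof.
case=> _ <-.
have idE l p : id_ket0 R N d p l = (p == mxtens_index (l, 0))%:R.
  case: (mxtens_indexP p) => k a.
  by rewrite id_ket0E (can_eq (@mxtens_indexK _ _)) xpair_eqE.
rewrite mxE (bigD1 (mxtens_index (j, 0))) //= big1 ?addr0 => [|p /negPf np].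
  rewrite idE eqxx mulr1 mxE (bigD1 (mxtens_index (i, 0))) //= big1 ?addr0.
    by rewrite adjmxE idE eqxx conjC1 mul1r.
  by move=> p /negPf np; rewrite adjmxE idE np conjC0 mul0r.
by rewrite idE np mulr0.
Qed.

Definition one_query_alg (R : realType) m : qalg R m 1 1 :=
  @QAlg R m 1 1 (fun _ => 1%:M) (fun _ => QPlain) (fun p => val p == 0%N).

Lemma one_query_alg_valid {R : realType} m : qalg_valid (one_query_alg R m).
Proof. by move=> t _; split; rewrite adjmx1 mulmx1. Qed.

Lemma one_query_prob {R : realType} {N d} (M : 'M[R[i]]_N.+1) U :
  block_encoding M U -> M 0 0 = (M 0 0 == 1)%:R ->
  prob_out (one_query_alg R (N.+1 * d.+1)) U (M 0 0 == 1) = 1.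
Proof.
set A := one_query_alg _ _ => enc bit.
have psiE : qstate A U 1 = (U *t 1%:M) *m ket0 R _ by rewrite /= !mul1mx.
have tot : prob_out A U true + prob_out A U false = 1.
  rewrite prob_outD psiE frob2_unitary ?frob2_ket0 ?muln_gt0 //.
  by apply: (@qgate_unitary _ _ 1 U QPlain); case: enc.
have pt : prob_out A U true = `|M 0 0| ^+ 2.
  pose p0 : 'I_(N.+1 * d.+1 * (2 * 1)) :=
    mxtens_index (mxtens_index (0, 0), mxtens_index (0 : 'I_2, 0 : 'I_1)).
  rewrite /prob_out (big_pred1 p0) => [|p]; last by rewrite /= eqb_id.
  by rewrite psiE (@mulmx_ket0 _ _ _ _ p0) // tensmxE mxE eqxx mulr1
    (block_encodingE M U 0 0 enc).
(* If the entry is 1, the probability of true is 1 directly; if it is 0, that probability vanishes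
   and the total of 1 falls to false. *)
rewrite pt bit in tot; rewrite bit in pt; case: (M 0 0 == 1) pt tot => pt.
  by rewrite pt normr1 expr1n.
by rewrite normr0 expr0n add0r.
Qed.

(* The dimension is N = n.+2 (so N >= 2).
   Answer "true" means <0|C|0> = 1, "false" means <0|C|0> = 0. *)
Theorem theorem2 (R : realType) :
  (* (i) one query to a block-encoding suffices, with certainty *)
  (forall (n : nat), forall d : nat,
     exists (w : nat) (A : qalg R (n.+2 * d.+1) w 1),
       qalg_valid A /\
       forall (Cm : 'M[R[i]]_n.+2) (U : 'M[R[i]]_(n.+2 * d.+1)),
         is_perm_matrix Cm -> block_encoding Cm U ->
         prob_out A U (Cm 0 0 == 1) = 1)
  /\
  (* (ii) with a state-preparation oracle, Omega(sqrt N) queries are needed *)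
  (exists c : R, 0 < c /\
     forall (n : nat), forall (w T : nat) (A : qalg R (n.+2 * n.+2) w T),
       qalg_valid A ->
       (forall (Cm : 'M[R[i]]_n.+2) (U : 'M[R[i]]_(n.+2 * n.+2)),
          is_perm_matrix Cm -> qunitary U ->
          U *m ket0 R (n.+2 * n.+2) = (sqrtC (n.+2%:R : R[i]))^-1 *: vecmx Cm ->
          2 / 3 <= prob_out A U (Cm 0 0 == 1)) ->
       c * Num.sqrt (n.+2%:R : R) <= T%:R).
Proof.
split=> [n d|].
  exists 1%N, (one_query_alg R _); split; first exact: one_query_alg_valid.
  move=> _ U [s ->] enc; apply: one_query_prob enc _.
  by rewrite !mxE pnatr_eq1 eqb1.
(* The bounds 18 and 64 combine to [N <= 1152 T^2], and [1152 <= 34^2 = 1156]. *)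
exists 34^-1; split=> [|n w T A vA correct]; first by rewrite invr_gt0 ltr0n.
have [O [O' [uO uO' Oe Oe' dist]]] := @hard_oracles R n.
have pt : 2 / 3 <= prob_out A O true.
  have := correct _ _ (ex_intro _ _ erefl) uO Oe.
  by rewrite !mxE perm1 !eqxx.
have pf : 2 / 3 <= prob_out A O' false.
  have := correct _ _ (ex_intro _ _ erefl) uO' Oe'.
  by rewrite !mxE tpermL eq_sym oner_eq0.
(* The query bound lives in the complex numbers; all its terms are real, so it descends to [R]. *)
have nT : 1 <= 18 * (T%:R ^+ 2) * (64 / n.+2%:R) :> R.
  have := le_trans (query_bound A O O' vA uO uO' pt pf)
    (ler_wpM2l (mulr_ge0 (ler0n _ 18) (ler0n _ _)) dist).
  rewrite -(rmorph_nat (real_complex R) 18) -(rmorph_nat (real_complex R) (T ^ 2)%N).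
  by rewrite -!(rmorphM (real_complex R)) -[1]/(1%:C%C) lecR natrX.
rewrite mulrC ler_pdivrMr ?ltr0n // -ler_sqr ?nnegrE ?sqrtr_ge0 ?mulr_ge0 ?ler0n //.
rewrite sqr_sqrtr ?ler0n //.
move: nT; rewrite mulrA ler_pdivlMr ?ltr0n // mul1r exprMn => nT.
by apply: le_trans nT _; nra.
Qed.
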